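(* Let $X$ be a smooth real Banach space of dimension $>3$. Suppose that for every pair of closed subspaces $Y,Z\subseteq X$ having property-$SU$ in $X$ and such that the sum $Y+Z$ is closed, $Y+Z$ also has property-$SU$ in $X$. Then $X$ is isometric to a Hilbert space.
   Context: All Banach spaces are real and subspaces are closed. For a closed subspace $Y$ of a Banach space $X$, $Y^\perp\subseteq X^*$ denotes the annihilator of $Y$. $Y$ has property-$SU$ in $X$ if $Y^\perp$ has a complementary subspace $G\subseteq X^*$ such that for every $f\in X^*$, writing $f=g+h$ with $g\in G$, $h\in Y^\perp$, one has $\|f\|>\|g\|$ whenever $h\neq 0$. $X$ is smooth if for every $x\in X$ with $\|x\|=1$ there is exactly one $f\in X^*$ with $\|f\|=1$ and $f(x)=1$. *)

(* Defs.v *)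
From HB Require Import structures.
From mathcomp Require Import all_boot all_order all_algebra.
From mathcomp Require Import sesquilinear.
From mathcomp Require Import all_classical all_reals all_analysis.

Set Implicit Arguments.
Unset Strict Implicit.
Unset Printing Implicit Defensive.

Import Order.TTheory GRing.Theory Num.Theory.
Import numFieldNormedType.Exports.

Local Open Scope classical_set_scope.
Local Open Scope ring_scope.

Definition cont_linear (R : realType) (X : normedModType R) : {pred X -> R^o} :=
  mem [set f : X -> R^o | linear f /\ continuous f].

Arguments cont_linear {R} X.

(* The dual X^* with the operator norm. *)
Record dual (R : realType) (X : normedModType R) : Type := Dual {
  dual_val :> X -> R^o;
  dual_valP : dual_val \in cont_linear X }.

Section DualSpace.
Context {R : realType} {X : normedModType R}.
Implicit Types f g : dual X.

HB.instance Definition _ := [isSub for @dual_val R X].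
HB.instance Definition _ := [Choice of dual X by <:].

Let cont_linear_submod_closed : submod_closed (cont_linear X).
Proof.
split.
  rewrite inE /= -[0]/(cst 0); split; last by move=> x; exact: cst_continuous.
  by move=> a u v; rewrite /cst scaler0 addr0.
move=> a f g; rewrite !inE /= => -[lf cf] [lg cg]; split.
  move=> b u v; rewrite !fctE lf lg !scalerDr !scalerA (mulrC b).
  by rewrite addrACA.
move=> x; apply: (@cvgD _ _ _ _ _ (a *: f) g); last exact: cg.
by apply: cvgZr; exact: cf.
Qed.

HB.instance Definition _ := GRing.isSubmodClosed.Build _ _ (cont_linear X)
  cont_linear_submod_closed.
HB.instance Definition _ := [SubChoice_isSubLmodule of dual X by <:].

Lemma dual_linear f : linear f.
Proof. by have := dual_valP f; rewrite inE => -[]. Qed.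

HB.instance Definition _ f :=
  GRing.isLinear.Build R X R^o *:%R (dual_val f) (dual_linear f).

Lemma dual_continuous f : continuous f.
Proof. by have := dual_valP f; rewrite inE => -[]. Qed.

Lemma dualP f g : (forall x, f x = g x) -> f = g.
Proof. by move=> fg; apply: val_inj; apply/funext. Qed.

Lemma dualDE f g x : (f + g) x = f x + g x. Proof. by []. Qed.

Lemma dualZE (a : R) f x : (a *: f) x = a * f x. Proof. by []. Qed.

Lemma dual0E x : (0 : dual X) x = 0. Proof. by []. Qed.

Definition dual_norm f : R := sup [set `|f x| | x in [set x | `|x| <= 1]].

Lemma dual_norm_has_sup f : has_sup [set `|f x| | x in [set x | `|x| <= 1]].
Proof.
split; first by exists `|f 0|, 0 => //=; rewrite normr0.
have /linear_bounded_continuous/linear_boundedP := @dual_continuous f.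
move=> /pinfty_ex_gt0 [r r0 fr]; exists r => _ [x /= x1 <-].
by apply: le_trans (fr x) _; rewrite ler_piMr // ltW.
Qed.

Lemma dual_norm_ub f x : `|x| <= 1 -> `|f x| <= dual_norm f.
Proof.
by move=> x1; apply: sup_upper_bound; [exact: dual_norm_has_sup|exists x].
Qed.

Lemma dual_norm_le f r :
  (forall x, `|x| <= 1 -> `|f x| <= r) -> dual_norm f <= r.
Proof.
move=> fr; apply: ge_sup; first by case: (dual_norm_has_sup f).
by move=> _ [x /= x1 <-]; exact: fr.
Qed.

Lemma dual_norm_bound f x : `|f x| <= dual_norm f * `|x|.
Proof.
have [->|x0] := eqVneq x 0; first by rewrite linear0 !normr0 mulr0.
have nx : 0 < `|x| by rewrite normr_gt0.
have := @dual_norm_ub f (`|x|^-1 *: x).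
rewrite linearZ /= !normrZ ger0_norm ?invr_ge0 // mulVf ?gt_eqF // => /(_ (lexx _)).
by rewrite mulrC ler_pdivrMr.
Qed.

Let dual_norm_ge0 f : 0 <= dual_norm f.
Proof. by rewrite (le_trans _ (@dual_norm_ub f 0 _)) // normr0. Qed.

Let dual_normD f g : dual_norm (f + g) <= dual_norm f + dual_norm g.
Proof.
apply: dual_norm_le => x x1; rewrite dualDE (le_trans (ler_normD _ _)) //.
by rewrite lerD // dual_norm_ub.
Qed.

Let dual_normZ_le (a : R) f : dual_norm (a *: f) <= `|a| * dual_norm f.
Proof.
apply: dual_norm_le => x x1; rewrite dualZE normrM ler_wpM2l //.
exact: dual_norm_ub.
Qed.

Let dual_normZ (a : R) f : dual_norm (a *: f) = `|a| * dual_norm f.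
Proof.
apply/eqP; rewrite eq_le dual_normZ_le /=.
have [->|a0] := eqVneq a 0; first by rewrite normr0 mul0r dual_norm_ge0.
rewrite -ler_pdivlMl ?normr_gt0 // -normfV.
by rewrite (le_trans _ (dual_normZ_le _ _)) // scalerA mulVf // scale1r.
Qed.

Let dual_norm0_eq0 f : dual_norm f = 0 -> f = 0.
Proof.
move=> f0; apply: dualP => x; apply/eqP; rewrite dual0E -normr_le0.
by rewrite (le_trans (dual_norm_bound f x)) // f0 mul0r.
Qed.

HB.instance Definition _ :=
  @Lmodule_isNormed.Build R (dual X) _ dual_normD dual_normZ dual_norm0_eq0.

Lemma dual_normE f : `|f| = sup [set `|f x| | x in [set x | `|x| <= 1]].
Proof. by []. Qed.

End DualSpace.

Definition closed_subspace (R : realType) (X : normedModType R) (Y : set X) :=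
  submod_closed (mem Y) /\ closed Y.

Definition set_add (R : realType) (X : normedModType R) (Y Z : set X) : set X :=
  [set y + z | y in Y & z in Z].

Definition annihilator (R : realType) (X : normedModType R) (Y : set X) :
  set (dual X) := [set f | forall y, Y y -> f y = 0].

Definition complementary (R : realType) (X : normedModType R) (V W : set X) :=
  V `&` W = [set 0] /\ set_add V W = setT.

Definition property_SU (R : realType) (X : normedModType R) (Y : set X) :=
  exists G : set (dual X),
    [/\ closed_subspace G, complementary G (annihilator Y) &
        forall f g h : dual X, G g -> annihilator Y h -> f = g + h ->
          h != 0 -> `|f| > `|g|].

Definition smooth (R : realType) (X : normedModType R) :=
  forall x : X, `|x| = 1 -> exists! f : dual X, `|f| = 1 /\ f x = 1.

(* Linear dimension; X may be infinite-dimensional. *)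
Definition dim_gt (R : realType) (X : normedModType R) (n : nat) :=
  exists e : 'I_n.+1 -> X, forall c : 'I_n.+1 -> R,
    \sum_i c i *: e i = 0 -> forall i, c i = 0.

Definition is_hilbert (R : realType) (H : completeNormedModType R) :=
  exists ip : {dot H for (@idfun R)}, forall u : H, `|u| ^+ 2 = ip u u.

(* Isometric isomorphism of Banach spaces, hence linear. *)
Definition isometric (R : realType) (X H : normedModType R) :=
  exists T : {linear X -> H}, bijective T /\ forall x, `|T x| = `|x|.

(* Main.v *)
(** In a smooth space every line has property SU, because the functional
    norming a vector is unique; by hypothesis every plane [span(p, q)] then
    has property SU too. The complement [G] attached to a plane [Y] is
    two-dimensional and contains the norming functional [J y] of each [y] in
    [Y], so [J (a p + b q)] is a linear combination of [J p] and [J q]: the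
    duality map [J] preserves collinearity of projective points. This forces
    strict convexity, and then, as in the fundamental theorem of projective
    geometry (which needs dimension at least 3), [J] agrees on every plane,
    up to scalar factors, with a linear map, that is, with a bilinear form
    [B]. Comparing the norm with [B] along the ellipse [B(v, v) = 1] shows
    that the norm is proportional to [exp (k u)] in the angle [u], where [k]
    measures the antisymmetric part of [B]; since [|-v| = |v|], [k = 0] and
    the norm is constant on the ellipse. Hence [J x y = J y x], so [J x y] is
    an inner product inducing the norm. *)

Require Import Defs.
From HB Require Import structures.
From mathcomp Require Import all_boot all_order all_algebra.
From mathcomp Require Import sesquilinear ring lra.
From mathcomp Require Import all_classical all_reals all_analysis.

Set Implicit Arguments.
Unset Strict Implicit.
Unset Printing Implicit Defensive.

Import Order.TTheory GRing.Theory Num.Theory.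
Import numFieldNormedType.Exports.

Local Open Scope classical_set_scope.
Local Open Scope ring_scope.

(** * Elementary estimates for sine, cosine and powers *)

Lemma normr_sin_le (R : realType) (x : R) : `|sin x| <= `|x|.
Proof.
wlog x0 : x / 0 <= x => [H|].
  have [/H//|/ltW x0] := leP 0 x.
  by have := H (- x); rewrite sinN !normrN oppr_ge0 x0; exact.
have [->|xn0] := eqVneq x 0; first by rewrite sin0.
have xp : 0 < x by rewrite lt_neqAle eq_sym xn0.
have [c _] : exists2 c, c \in `]0, x[ & sin x - sin 0 = cos c * (x - 0).
  apply: MVT => //.
  by apply: continuous_subspaceT => ?; exact: continuous_sin.
rewrite sin0 !subr0 => ->; rewrite normrM ler_piMl //.
exact: cos_max.
Qed.

Lemma cos_ge_1Bsqr (R : realType) (x : R) : 1 - x ^+ 2 / 2 <= cos x.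
Proof.
have -> : x = (x / 2) *+ 2 by rewrite -mulr_natr divfK.
rewrite cos_mulr2n cos2sin2.
have := normr_sin_le (x / 2).
rewrite -ler_sqr ?nnegrE // !real_normK ?num_real //.
move: (sin _) => s; move: (x / 2) => y; lra.
Qed.

Lemma bernoulli (R : realType) (x : R) n : x <= 1 -> 1 - x *+ n <= (1 - x) ^+ n.
Proof.
move=> x1; elim: n => [|n IH]; first by rewrite mulr0n expr0 subr0.
have y0 : 0 <= 1 - x by lra.
rewrite exprSr; apply: le_trans (ler_wpM2r y0 IH).
have : 0 <= x *+ n * x by rewrite mulrnAl mulrn_wge0 // -expr2 sqr_ge0.
by rewrite mulrSr; move: (x *+ n) => y; nra.
Qed.

(** * Functions growing at least like an exponential *)

Section Growth.
Context {R : realType}.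

Lemma growth_iter (g : R -> R) (k h : R) :
  0 <= cos h + k * sin h ->
  (forall t, g t * (cos h + k * sin h) <= g (t + h)) ->
  forall n t, g t * (cos h + k * sin h) ^+ n <= g (t + h *+ n).
Proof.
move=> r0 H; elim=> [|n IH] t; first by rewrite expr0 mulr1 mulr0n addr0.
rewrite exprSr mulrA mulrSr addrA.
by apply: le_trans (H _); apply: ler_wpM2r.
Qed.

(** If [k > 0], a step [h = pi / n.+1] below both [1] and [k] has growth factor above 1, so [n.+1]
    steps from [0] to [pi] strictly increase [g], against [g pi = g 0]. *)
Lemma growth_rate_le0 (g : R -> R) (k : R) :
  0 < g 0 -> g pi = g 0 ->
  (forall t h, g t * (cos h + k * sin h) <= g (t + h)) -> k <= 0.
Proof.
move=> g0 gp H; rewrite leNgt; apply/negP => k0.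
have [n nE] : exists n : nat, pi / n.+1%:R < Num.min 1 k :> R.
  have m0 : 0 < Num.min 1 k by rewrite lt_min ltr01.
  exists (Num.truncn (pi / Num.min 1 k)).
  rewrite ltr_pdivrMr // mulrC -ltr_pdivrMr //.
  by apply: truncnS_gt.
set h := pi / n.+1%:R in nE.
have hp : 0 < h by rewrite divr_gt0 // pi_gt0.
have : (h < 1) && (h < k) by rewrite -lt_min.
move=> /andP[h1 hk].
have r1 : 1 < cos h + k * sin h.
  (* By half angles the claim becomes [sin (h / 2) < k * cos (h / 2)], which holds since
     [sin (h / 2) <= h / 2 < k / 2] and [cos (h / 2) >= 1 / 2]. *)
  have -> : h = (h / 2) *+ 2 by rewrite -mulr_natr divfK.
  rewrite cos_mulr2n sin_mulr2n cos2sin2.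
  have s0 : 0 < sin (h / 2) by apply: sin2_gt0; lra.
  have sh : sin (h / 2) <= h / 2.
    by have := normr_sin_le (h / 2); rewrite !ger0_norm //; lra.
  have ch := cos_ge_1Bsqr (h / 2).
  have c1 : 1 / 2 <= cos (h / 2).
    by move: (cos _) ch => c; rewrite expr_div_n; nra.
  have skc : sin (h / 2) < k * cos (h / 2).
    by have := ler_wpM2l (ltW k0) c1; lra.
  move: (sin _) (cos _) s0 skc {sh ch c1} => s c s0 skc.
  nra.
have r0 : 0 <= cos h + k * sin h by lra.
have := growth_iter r0 (fun t => H t h) n.+1 0.
rewrite add0r -mulr_natr divfK // gp leNgt => /negP; apply.
by rewrite ltr_pMr // exprn_egt1.
Qed.

(** The bound on the rate, applied to [g] and to its reflection, gives [k = 0]. Then [n] steps of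
    length [u / n] multiply [g] by at least [cos (u / n) ^+ n], which tends to 1, so [g] decreases
    in neither direction. *)
Lemma growth_const (g : R -> R) (k : R) :
  (forall t, 0 < g t) -> g pi = g 0 -> g (- pi) = g 0 ->
  (forall t h, g t * (cos h + k * sin h) <= g (t + h)) ->
  k = 0 /\ forall t, g t = g 0.
Proof.
move=> g0 gp gNp H.
have k0 : k = 0.
  apply/eqP; rewrite eq_le (growth_rate_le0 (g0 0) gp H) /= -oppr_le0.
  apply: (@growth_rate_le0 (fun t => g (- t))) => /=.
  - by rewrite oppr0.
  - by rewrite oppr0.
  - move=> t h; have := H (- t) (- h); rewrite cosN sinN opprD.
    by rewrite mulrN mulNr.
split=> //.
suff gle t u : g t <= g (t + u).
  move=> t; apply/eqP; rewrite eq_le -{2}[t]add0r gle andbT.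
  by rewrite -[X in _ <= g X](subrr t) gle.
rewrite leNgt; apply/negP => gu.
pose e := g t - g (t + u); have e0 : 0 < e by rewrite subr_gt0.
(* The first two terms keep [h ^+ 2 / 2 <= 1], as Bernoulli requires; the last makes the total loss
   smaller than [e]. *)
pose M := 1 + u ^+ 2 + g t * u ^+ 2 / e.
pose n := Num.truncn M.
have nM : M < n.+1%:R by apply: truncnS_gt.
have g0t := g0 t.
have n0 : (0 : R) < n.+1%:R by [].
have w0 : 0 <= g t * u ^+ 2 / e 
  by apply: divr_ge0 (ltW e0); apply: mulr_ge0 (ltW g0t) (sqr_ge0 u).
have u0 := sqr_ge0 u.
set h := u / n.+1%:R; set x := h ^+ 2 / 2.
have x1 : x *+ n.+1 = u ^+ 2 / n.+1%:R / 2.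
  by rewrite /x /h -mulr_natr; field; rewrite gt_eqF // ; lra.
have hh : h ^+ 2 / 2 <= 1.
  rewrite /h expr_div_n -/n ler_pdivrMr // mul1r ler_pdivrMr ?exprn_gt0 //.
  rewrite /M in nM; nra.
have ch : 1 - x <= cos h + k * sin h by rewrite k0 mul0r addr0 cos_ge_1Bsqr.
have x10 : 0 <= 1 - x by rewrite subr_ge0.
have := growth_iter (le_trans x10 ch) (fun t => H t h) n.+1 t.
rewrite -[h *+ _]mulr_natr divfK ?gt_eqF // leNgt => /negP; apply.
have g1 : g t * (1 - x *+ n.+1) <= g t * (cos h + k * sin h) ^+ n.+1.
  rewrite ler_pM2l //; apply: le_trans (bernoulli _ hh) _.
  by apply: lerXn2r (ch); rewrite nnegrE // (le_trans x10 ch).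
apply: lt_le_trans g1.
rewrite x1.
have : g t * (u ^+ 2 / n.+1%:R) < e.
  rewrite mulrA ltr_pdivrMr // [e * _]mulrC -ltr_pdivrMr //.
  by apply: le_lt_trans nM; rewrite /M; lra.
have : 0 <= g t * (u ^+ 2 / n.+1%:R) by rewrite mulr_ge0 ?divr_ge0 // ltW.
by rewrite /e; move: (_ / _) => Q; lra.
Qed.
End Growth.

(** Nonnegative reals are squares and squares go to squares, so [k] is monotone; it fixes the
    rationals, which are dense. *)
Lemma field_endo_id (R : realType) (k : R -> R) :
  (forall s t, k (s + t) = k s + k t) -> (forall s t, k (s * t) = k s * k t) ->
  k 1 = 1 -> forall t, k t = t.
Proof.
move=> kD kM k1.
have k0 : k 0 = 0.
  by have := kD 0 0; rewrite addr0 => /eqP; rewrite -subr_eq0; lra.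
have kN t : k (- t) = - k t.
  by apply/eqP; rewrite -addr_eq0 addrC -kD subrr k0.
have kle s t : s <= t -> k s <= k t.
  move=> st; rewrite -subr_ge0 -kN -kD.
  rewrite -[t - s]sqr_sqrtr ?subr_ge0 // expr2 kM -expr2; exact: sqr_ge0.
have kn n : k n%:R = n%:R.
  by elim: n => // n IH; rewrite -!natr1 kD IH k1.
have kz (z : int) : k z%:~R = z%:~R.
  case: z => n; first by rewrite -pmulrn kn.
  by rewrite NegzE mulrNz kN -pmulrn kn.
have kq (q : rat) : k (ratr q) = ratr q.
  have d0 : (denq q)%:~R != 0 :> R by rewrite intr_eq0 denq_neq0.
  have qd : ratr q * (denq q)%:~R = (numq q)%:~R :> R by rewrite /ratr divfK.
  move: (ratr q) qd => r rd.
  by apply: (mulIf d0); rewrite rd -(kz (numq q)) -rd kM kz.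
move=> t; apply/eqP; rewrite eq_le !leNgt; apply/andP; split; apply/negP => kt.
- have [q] := rat_in_itvoo kt; rewrite in_itv /= => /andP[tq qk].
  by have := kle _ _ (ltW tq); rewrite kq leNgt qk.
- have [q] := rat_in_itvoo kt; rewrite in_itv /= => /andP[tq qk].
  by have := kle _ _ (ltW qk); rewrite kq leNgt tq.
Qed.
(* Here [j x y] is [J x y] for the duality map [J], normalized by
   [|J x| = |x|]; [sip_uniq] is smoothness at [x]. *)
Record semi_inner_product (R : realType) (X : normedModType R)
    (j : X -> X -> R) : Prop := SemiInnerProduct {
  sipD : forall x y z, j x (y + z) = j x y + j x z ;
  sipZ : forall x a y, j x (a *: y) = a * j x y ;
  sipxx : forall x, j x x = `|x| ^+ 2 ;
  sip_le : forall x y, `|j x y| <= `|x| * `|y| ;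
  sip_uniq : forall x (g : X -> R), (forall y z, g (y + z) = g y + g z) ->
    (forall a y, g (a *: y) = a * g y) -> (forall y, `|g y| <= `|x| * `|y|) ->
    g x = `|x| ^+ 2 -> forall y, g y = j x y ;
  sip_span : forall p q a b, j p p * j q q != j p q * j q p ->
    exists c d, forall z, j (a *: p + b *: q) z = c * j p z + d * j q z }.

(** * Semi-inner products: homogeneity, strict convexity, projective action *)

Section SemiInnerProduct.
Context {R : realType} {X : normedModType R} {j : X -> X -> R}.
Context (jP : semi_inner_product j).
Context (dim3 : forall x y : X, exists z, forall a b, z != a *: x + b *: y).

Let jD := sipD jP.
Let jZ := sipZ jP.
Let jxx := sipxx jP.
Let jle := sip_le jP.

Lemma sip0 x : j x 0 = 0.
Proof. by rewrite -(scale0r x) jZ mul0r. Qed.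

Lemma sip0l x : j 0 x = 0.
Proof.
by apply/eqP; rewrite -normr_le0; have := jle 0 x; rewrite normr0 mul0r.
Qed.

Lemma sipZl a x y : j (a *: x) y = a * j x y.
Proof.
symmetry; apply: (sip_uniq jP (g := fun y => a * j x y)).
- by move=> u v; rewrite jD mulrDr.
- by move=> b u; rewrite jZ mulrCA.
- by move=> u /=; rewrite normrM normrZ -mulrA ler_wpM2l.
- by rewrite jZ jxx normrZ exprMn real_normK ?num_real // mulrA.
Qed.

Lemma sip_gt0 x : x != 0 -> 0 < j x x.
Proof. by move=> x0; rewrite jxx exprn_gt0 // normr_gt0. Qed.

(* Strict convexity. Let [f = j x = j y] with [x != y] and [c = y - x]. For [d]
   in the kernel of [f], the point [x + t d = y + t (d - c / t)] has its
   functional both in [span(f, j d)] and in [span(f, j (d - c / t))]; when it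
   is long enough not to be normed by [f], these planes coincide. Moving in
   small steps, [j (d0 + s c)] stays in one plane [span(f, j d0)] for all
   real [s], and evaluating at the common zero of this plane is absurd. *)
Section EqualFunctionals.
Context (x y : X).
Context (x1 : `|x| = 1) (y1 : `|y| = 1) (jxy : forall z, j x z = j y z).

Let jxx1 : j x x = 1. Proof. by rewrite jxx x1 expr1n. Qed.

Let jyx1 : j x y = 1. Proof. by rewrite jxy jxx y1 expr1n. Qed.

Let c := y - x.

Let jxc : j x c = 0.
Proof. by rewrite jD jyx1 -scaleN1r jZ jxx1; lra. Qed.

Lemma sip_span_shift d t : d != 0 -> d - t^-1 *: c != 0 -> j x d = 0 ->
  2 < `|t| * `|d| ->
  exists a b, forall z, j (d - t^-1 *: c) z = a * j x z + b * j d z.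
Proof.
set d' := d - _ => d0 d'0 xd t2.
have t0 : t != 0 by apply: contraTneq t2 => ->; rewrite normr0 mul0r -leNgt.
have xd' : j x d' = 0 by rewrite jD xd -scaleNr jZ jxc mulr0 addr0.
pose q := x + t *: d.
have q1 : 1 < `|q|.
  have := ler_normB q x; rewrite {2}/q addrAC subrr add0r normrZ x1; lra.
have qE : q = 1 *: y + t *: d'.
  rewrite scale1r scalerBr scalerA divff // scale1r /c opprB.
  by rewrite addrCA [y + _]addrC subrK addrC.
have [|a1 [b1 H1]] := @sip_span _ _ _ jP x d 1 t.
  by rewrite xd mul0r jxx1 mul1r gt_eqF // sip_gt0.
have [|a2 [b2 H2]] := @sip_span _ _ _ jP y d' 1 t.
  by rewrite -!jxy xd' mul0r jyx1 mul1r gt_eqF // sip_gt0.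
rewrite -qE in H2; rewrite scale1r -/q in H1.
(* Otherwise [j q] is [|q| ^+ 2] times [j x], and evaluation at the unit vector [x] gives
   [|q| ^+ 2 <= |q|], against [1 < |q|]. *)
have b20 : b2 != 0.
  apply/eqP => b20; move: q1; rewrite ltNge => /negP; apply.
  have jqx z : j q z = a2 * j x z by rewrite H2 b20 mul0r addr0 jxy.
  have a2E : a2 = `|q| ^+ 2.
    by rewrite -jxx jqx /q jD jZ xd mulr0 addr0 jxx1 mulr1.
  have q0 := normr_ge0 q.
  have := jle q x; rewrite jqx jxx1 mulr1 x1 mulr1 a2E ger0_norm ?sqr_ge0 //.
  by nra.
exists ((a1 - a2) / b2), (b1 / b2) => z.
have : a1 * j x z + b1 * j d z = a2 * j x z + b2 * j d' z.
  by rewrite -H1 H2 jxy.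
move=> E; apply: (mulfI b20).
by rewrite -[b2 * _](addKr (a2 * j x z)) -E; field.
Qed.

Lemma sip_inj_unit : x = y.
Proof.
apply/eqP/negPn/negP => xNy.
have c0 : c != 0 by rewrite subr_eq0 eq_sym.
have cn0 : 0 < `|c| by rewrite normr_gt0.
have jcc := sip_gt0 c0.
have [z0 z0P] := dim3 x c.
pose d0 := z0 - j x z0 *: x.
have xd0 : j x d0 = 0 by rewrite jD -scaleNr jZ jxx1; lra.
have d0c s : d0 + s *: c != 0.
  apply: contraNneq (z0P (j x z0) (- s)) => E.
  by rewrite -subr_eq0 -E scaleNr opprD opprK addrA.
(* [D] projects along [c], so it is constant on the line [d0 + s *: c]. This bounds the norm below
   on the whole line, hence one step size serves everywhere. *)
pose D z := z - (j c z / j c c) *: c.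
have Dd s : D (d0 + s *: c) = D d0.
  rewrite /D jD jZ mulrDl mulfK ?gt_eqF // scalerDl opprD.
  by rewrite addrACA subrr addr0.
have Dle z : `|D z| <= 2 * `|z|.
  apply: le_trans (ler_normB _ _) _.
  rewrite normrZ normrM normfV (ger0_norm (ltW jcc)).
  suff : `|j c z| / j c c * `|c| <= `|z| by lra.
  rewrite mulrAC ler_pdivrMr // jxx expr2.
  by have := ler_wpM2r (ltW cn0) (jle c z); nra.
pose m := `|D d0| / 2.
have m0 : 0 < m.
  by rewrite divr_gt0 // normr_gt0 /D -scaleNr d0c.
have mle s : m <= `|d0 + s *: c|.
  by have := Dle (d0 + s *: c); rewrite Dd /m; lra.
have xds s : j x (d0 + s *: c) = 0 by rewrite jD xd0 jZ jxc mulr0 addr0.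
pose P s := exists a b, forall z, j (d0 + s *: c) z = a * j x z + b * j d0 z.
have P0 : P 0.
  by exists 0, 1 => z; rewrite scale0r addr0 mul0r mul1r add0r.
have Pstep s h : `|h| * 2 < m -> P s -> P (s + h).
  have [->|h0] := eqVneq h 0; first by rewrite addr0.
  move=> hm [a [b Ps]].
  have hE : d0 + (s + h) *: c = d0 + s *: c - (- h^-1)^-1 *: c.
    by rewrite invrN invrK scaleNr opprK scalerDl addrA.
  have [||||a' [b' H]] := @sip_span_shift (d0 + s *: c) (- h^-1).
  - exact: d0c.
  - by rewrite -hE d0c.
  - exact: xds.
  - rewrite normrN normfV ltr_pdivlMl ?normr_gt0 //.
    exact: lt_le_trans hm (mle s).
  rewrite /P hE; exists (a' + b' * a), (b' * b) => z.
  by rewrite H Ps; ring.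
have Pall s : P s.
  have [n nP] : exists n : nat, `|s / n.+1%:R| * 2 < m.
    exists (Num.truncn (`|s| * 2 / m)).
    rewrite normrM normfV normr_nat mulrAC ltr_pdivrMr //.
    by rewrite -ltr_pdivrMl // mulrC truncnS_gt.
  have -> : s = s / n.+1%:R *+ n.+1 by rewrite -[RHS]mulr_natr divfK.
  elim: {2}n.+1 => [//|k IH]; by rewrite mulrSr; exact: Pstep.
(* In this case every [j v] with [v] on the line kills [c], so [|v| ^+ 2 = j v d0] and
   [|v| <= |d0|]; a far point of the line contradicts this. *)
have [A0|A0] := eqVneq (j d0 c) 0.
  pose s := 3 * `|d0| / `|c|.
  have [a [b H]] := Pall s; set v := d0 + s *: c in H.
  have vc : j v c = 0 by rewrite H jxc A0 !mulr0 addr0.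
  have vd : `|v| <= `|d0|.
    have := jxx v; rewrite {2}/v jD jZ vc mulr0 addr0 => E.
    have := ler_norm (j v d0); have := jle v d0.
    have : 0 < `|v| by rewrite normr_gt0 d0c.
    by rewrite E; nra.
  have : 0 < `|d0| by have := d0c 0; rewrite scale0r addr0 normr_gt0.
  have := ler_normB v d0; rewrite {2}/v addrAC subrr add0r normrZ.
  rewrite ger0_norm ?divr_ge0 ?mulr_ge0 // /s divfK ?gt_eqF //; lra.
(* This is the point of the line where [j d0] vanishes, as [j x] does already. *)
pose s := - (j d0 d0 / j d0 c).
have [a [b H]] := Pall s.
have := sip_gt0 (d0c s); rewrite H xds jD jZ /s mulNr divfK // subrr !mulr0.
by rewrite addr0 ltxx.
Qed.

End EqualFunctionals.

(** Comparing the norms of the two functionals gives [|a| * |y| = |x|]. After normalization, with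
    the sign of [a] moved into [y], this is the case of unit vectors. *)
Lemma sip_inj x y a : x != 0 -> y != 0 -> (forall z, j x z = a * j y z) ->
  exists b, x = b *: y.
Proof.
move=> x0 y0 H.
have nx : 0 < `|x| by rewrite normr_gt0.
have ny : 0 < `|y| by rewrite normr_gt0.
have a0 : a != 0.
  by apply: contraTneq (sip_gt0 x0) => a0; rewrite H a0 mul0r ltxx.
pose b := `|x| / (a * `|y| ^+ 2) * `|a| * `|y|.
pose e : R := Num.sg a.
have e1 : `|e| = 1 by rewrite normr_sg a0.
have aE : `|a| * `|y| = `|x|.
  apply/eqP; rewrite eq_le; apply/andP; split.
    have := jle x y; rewrite H jxx normrM (ger0_norm (sqr_ge0 _)) expr2 mulrA.
    by rewrite ler_pM2r.
  have yx := jle y x; have := jxx x; rewrite H => E.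
  have : `|a * j y x| = `|x| ^+ 2 by rewrite E ger0_norm // sqr_ge0.
  rewrite normrM => {}E; rewrite -(ler_pM2r nx) -expr2 -E -mulrA.
  exact: ler_wpM2l.
have E : `|x|^-1 *: x = (e / `|y|) *: y.
  apply: sip_inj_unit => [||z].
  - by rewrite normrZ normfV normr_id mulVf ?gt_eqF.
  - by rewrite normrZ normrM e1 mul1r normfV normr_id mulVf ?gt_eqF.
  - rewrite !sipZl H -aE invfM mulrA; congr (_ * _).
    have -> : a = e * `|a| by rewrite -numEsg.
    by rewrite normrM e1 mul1r normr_id; field; rewrite !gt_eqF ?normr_gt0.
exists (`|x| * (e / `|y|)).
by rewrite -scalerA -E scalerA divff ?gt_eqF // scale1r.
Qed.

(** A zero determinant forces equality in [|j p q| <= |p| * |q|]. Then a multiple of [j p] norms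
    [q], hence equals [j q] by uniqueness, and [sip_inj] makes [q] collinear with [p]. *)
Lemma sip_det p q : p != 0 -> (forall a, q != a *: p) ->
  j p p * j q q != j p q * j q p.
Proof.
move=> p0 qp; apply/eqP => E.
have np : 0 < `|p| by rewrite normr_gt0.
have q0 : q != 0 by have := qp 0; rewrite scale0r.
have nq : 0 < `|q| by rewrite normr_gt0.
have h : `|j p q| = `|p| * `|q|.
  apply/eqP; rewrite eq_le jle /=.
  have E2 : `|p| ^+ 2 * `|q| ^+ 2 = `|j p q| * `|j q p|.
    by rewrite -normrM -E !jxx ger0_norm // mulr_ge0 // sqr_ge0.
  have := ler_wpM2l (normr_ge0 (j p q)) (jle q p); rewrite -E2.
  rewrite -exprMn expr2 [`|q| * _]mulrC ler_pM2r //; exact: mulr_gt0.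
have jpq0 : j p q != 0 by rewrite -normr_gt0 h mulr_gt0.
have [b qE] : exists b, q = b *: p.
  apply: (@sip_inj q p (`|q| ^+ 2 / j p q)) => // z; symmetry.
  apply: (sip_uniq jP (g := fun z => `|q| ^+ 2 / j p q * j p z)).
  - by move=> u v; rewrite jD mulrDr.
  - by move=> c u; rewrite jZ mulrCA.
  - move=> u; rewrite !normrM normfV h ger0_norm ?normr_ge0 //.
    rewrite mulrAC ler_pdivrMr ?mulr_gt0 //.
    have := jle p u; have := normr_ge0 u; nra.
  - by rewrite divfK.
by have := qp b; rewrite {1}qE eqxx.
Qed.

Lemma sip_add p q : exists a b, forall z, j (p + q) z = a * j p z + b * j q z.
Proof.
have [->|p0] := eqVneq p 0.
  by exists 0, 1 => z; rewrite add0r mul0r mul1r add0r.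
have [[a ->]|qp] := pselect (exists a, q = a *: p).
  exists (1 + a), 0 => z.
  by rewrite -{1}[p]scale1r -scalerDl sipZl mul0r addr0.
have [|a [b H]] := @sip_span _ _ _ jP p q 1 1.
  by apply: sip_det => // a; apply/eqP => qE; apply: qp; exists a.
by exists a, b => z; rewrite -H !scale1r.
Qed.

Lemma noncollinear_eq0 (p q : X) a b : p != 0 -> (forall c, q != c *: p) ->
  a *: p + b *: q = 0 -> a = 0 /\ b = 0.
Proof.
move=> p0 qp E; have [b0|b0] := eqVneq b 0.
  move: E; rewrite b0 scale0r addr0 => /eqP; rewrite scaler_eq0 (negPf p0) orbF.
  by move=> /eqP.
have /eqP[] := qp (- (a / b)); apply: (scalerI b0).
rewrite scalerA mulrN mulrC divfK // scaleNr.
by apply/eqP; rewrite -addr_eq0 addrC E.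
Qed.

(** Here [k] is the affine coordinate of the image of the projective point [p + t *: q]. Were a
    coefficient zero for [t != 0], [sip_inj] would make this point collinear with [p] or [q]. *)
Lemma sip_slope p q : p != 0 -> (forall a, q != a *: p) ->
  forall t, exists k, (k == 0) = (t == 0) /\
    exists2 l, l != 0 & forall z, j (p + t *: q) z = l * (j p z + k * j q z).
Proof.
move=> p0 qp t; have [->|t0] := eqVneq t 0.
  exists 0; split; first by rewrite eqxx.
  by exists 1 => // z; rewrite scale0r addr0; ring.
have [a [b H]] := sip_add p (t *: q).
have q0 : q != 0 by have := qp 0; rewrite scale0r.
have indep c d : c *: p + d *: q = 0 -> c = 0 /\ d = 0.
  exact: noncollinear_eq0.
have pq0 : p + t *: q != 0.
  apply/eqP => E; have [|/eqP] := indep 1 t; first by rewrite scale1r.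
  by rewrite oner_eq0.
have a0 : a != 0.
  apply/eqP => a0.
  have [|c E] := @sip_inj (p + t *: q) q (b * t) pq0 q0.
    by move=> z; rewrite H a0 sipZl; ring.
  have [|/eqP] := indep 1 (t - c); last by rewrite oner_eq0.
  by rewrite scale1r scalerBl addrA E subrr.
have b0 : b != 0.
  apply/eqP => b0.
  have [|c E] := @sip_inj (p + t *: q) p a pq0 p0.
    by move=> z; rewrite H b0; ring.
  have [|_ /eqP] := indep (1 - c) t; last by rewrite (negPf t0).
  by rewrite scalerBl scale1r addrAC E subrr.
exists (b * t / a); split.
  by rewrite !mulf_eq0 invr_eq0 (negPf a0) (negPf b0) (negPf t0).
by exists a => // z; rewrite H sipZl; field.
Qed.

(** * Frames of three vectors and the induced projective map *)

Section Frame.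
Context (e1 e2 e3 : X).
Context (e10 : e1 != 0) (e20 : e2 != 0) (e30 : e3 != 0).
Context (j12 : j e1 e2 = 0) (j13 : j e1 e3 = 0) (j23 : j e2 e3 = 0).

Let d1 : j e1 e1 != 0. Proof. by rewrite gt_eqF // sip_gt0. Qed.
Let d2 : j e2 e2 != 0. Proof. by rewrite gt_eqF // sip_gt0. Qed.
Let d3 : j e3 e3 != 0. Proof. by rewrite gt_eqF // sip_gt0. Qed.

(** Orthogonality is only one-sided, but evaluation at [e3], [e2], [e1] in this order gives a
    triangular system. *)
Lemma frame_functionals_inj a1 a2 a3 b1 b2 b3 :
  (forall z, a1 * j e1 z + a2 * j e2 z + a3 * j e3 z =
             b1 * j e1 z + b2 * j e2 z + b3 * j e3 z) ->
  [/\ a1 = b1, a2 = b2 & a3 = b3].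
Proof.
move=> H.
have E3 : a3 = b3.
  by apply: (mulIf d3); have := H e3; rewrite j13 j23 !mulr0 !add0r.
have E2 : a2 = b2.
  apply: (mulIf d2); have := H e2; rewrite j12 !mulr0 !add0r E3.
  exact: addIr.
split=> //; apply: (mulIf d1); have := H e1; rewrite E2 E3 -!addrA.
exact: addIr.
Qed.

Lemma frame_neq0 s t : e1 + t *: e2 + s *: e3 != 0.
Proof.
apply/eqP => /(congr1 (j e1)); rewrite !jD !jZ j12 j13 !mulr0 !addr0 sip0.
exact/eqP.
Qed.

(* The induced map of projective planes is a collineation fixing the frame
   up to scale, so in affine coordinates its components satisfy
   [k13 s = k12 t * k23 (s / t)] and [k12] is additive; hence [k12] is
   proportional to a field endomorphism of the reals. *)
Lemma frame_linear : exists2 a, a != 0 & forall s t, exists l, forall z,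
  j (s *: e1 + t *: e2) z = l * (s * j e1 z + a * t * j e2 z).
Proof.
have n12 a : e2 != a *: e1.
  apply/eqP => E; move: d1 j12; rewrite E jZ => + /eqP.
  rewrite mulf_eq0 => /negPf -> /[!orbF] /eqP a0.
  by move: e20; rewrite E a0 scale0r eqxx.
have n13 a : e3 != a *: e1.
  apply/eqP => E; move: d1 j13; rewrite E jZ => + /eqP.
  rewrite mulf_eq0 => /negPf -> /[!orbF] /eqP a0.
  by move: e30; rewrite E a0 scale0r eqxx.
have n23 a : e3 != a *: e2.
  apply/eqP => E; move: d2 j23; rewrite E jZ => + /eqP.
  rewrite mulf_eq0 => /negPf -> /[!orbF] /eqP a0.
  by move: e30; rewrite E a0 scale0r eqxx.
have /choice[k12 k12P] := sip_slope e10 n12.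
have /choice[k13 k13P] := sip_slope e10 n13.
have /choice[k23 k23P] := sip_slope e20 n23.
have k12_eq0 t : (k12 t == 0) = (t == 0) by case: (k12P t).
have k13_eq0 t : (k13 t == 0) = (t == 0) by case: (k13P t).
have k23_eq0 t : (k23 t == 0) = (t == 0) by case: (k23P t).
(* The vector is split both as [(e1 + t *: e2) + s *: e3] and as [(e1 + s *: e3) + t *: e2];
   matching coefficients shows that the two slopes do not interact. *)
have J123 t s : exists2 l, l != 0 & forall z,
    j (e1 + t *: e2 + s *: e3) z =
      l * (j e1 z + k12 t * j e2 z + k13 s * j e3 z).
  have [_ [l2 l20 H2]] := k12P t; have [_ [l3 l30 H3]] := k13P s.
  have [a [b H]] := sip_add (e1 + t *: e2) (s *: e3).
  have [a' [b' H']] := sip_add (e1 + s *: e3) (t *: e2).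
  have [E1 E2 E3] : [/\ a * l2 = a' * l3, a * l2 * k12 t = b' * t
      & b * s = a' * l3 * k13 s].
    apply: frame_functionals_inj => z.
    have := H z; rewrite addrAC H' H2 H3 !sipZl => E.
    transitivity (a * (l2 * (j e1 z + k12 t * j e2 z)) + b * (s * j e3 z)).
      by ring.
    by rewrite -E; ring.
  have HL z : j (e1 + t *: e2 + s *: e3) z =
      a * l2 * (j e1 z + k12 t * j e2 z + k13 s * j e3 z).
    rewrite H H2 sipZl [b * _]mulrA E3 -E1; ring.
  exists (a * l2) => //; apply: contraTneq (sip_gt0 (frame_neq0 s t)) => E0.
  by rewrite HL E0 mul0r ltxx.
(* A third splitting: [e1] plus a multiple of [e2 + (s / t) *: e3]. *)
have k13E t s : t != 0 -> k13 s = k12 t * k23 (s / t).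
  move=> t0; have [l l0 H] := J123 t s.
  have [_ [m m0 H2]] := k23P (s / t).
  have [a [b H']] := sip_add e1 (t *: (e2 + (s / t) *: e3)).
  have [E1 E2 E3] : [/\ l = a, l * k12 t = b * t * m
      & l * k13 s = b * t * m * k23 (s / t)].
    apply: frame_functionals_inj => z.
    have := H' z; rewrite sipZl H2 scalerDr scalerA [t * _]mulrC divfK // addrA.
    rewrite H => E.
    transitivity (l * (j e1 z + k12 t * j e2 z + k13 s * j e3 z)); first by ring.
    by rewrite E; ring.
  by apply: (mulfI l0); rewrite E3 -E2 mulrA.
have k12n1 : k12 1 != 0 by rewrite k12_eq0 oner_eq0.
have k23n1 : k23 1 != 0 by rewrite k23_eq0 oner_eq0.
have z12 : k12 0 = 0 by apply/eqP; rewrite k12_eq0.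
have z13 : k13 0 = 0 by apply/eqP; rewrite k13_eq0.
have k13r s : k13 s = k12 s * k23 1.
  have [->|s0] := eqVneq s 0; first by rewrite z12 z13 mul0r.
  by rewrite (@k13E s s) // divff.
have k23r s : k23 s = k12 s * k23 1 / k12 1.
  rewrite -k13r (@k13E 1 s) ?oner_eq0 // divr1.
  by rewrite mulrC mulKf.
pose k t := k12 t / k12 1.
have kid : forall t, k t = t.
  apply: field_endo_id => [s t|s t|]; last by rewrite /k divff.
  (* Additivity comes from [e1 + (t + s) *: e2 + s *: e3 = (e1 + t *: e2) + s *: (e2 + e3)]. *)
  - rewrite /k -mulrDl; congr (_ / _).
    have [l l0 H] := J123 (t + s) s.
    have [_ [l2 l20 H2]] := k12P t; have [_ [l3 l30 H3]] := k23P 1.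
    have [a [b H']] := sip_add (e1 + t *: e2) (s *: (e2 + 1 *: e3)).
    have [E1 E2 E3] : [/\ l = a * l2,
        l * k12 (t + s) = a * l2 * k12 t + b * s * l3 & l * k13 s = b * s * l3 * k23 1].
      apply: frame_functionals_inj => z.
      have := H' z; rewrite sipZl H2 H3 scalerDr scale1r addrA.
      rewrite -[e1 + _ + s *: e2]addrA -scalerDl H => E.
      transitivity (l * (j e1 z + k12 (t + s) * j e2 z + k13 s * j e3 z)).
        by ring.
      by rewrite E; ring.
    have E : l * k12 s = b * s * l3.
      by apply: (mulIf k23n1); rewrite -E3 k13r mulrA.
    by apply: (mulfI l0); rewrite addrC E2 -E1 -E mulrDr addrC.
  - have [->|t0] := eqVneq t 0; first by rewrite /k mulr0 z12 mul0r mulr0.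
    have := k13E t (s * t) t0; rewrite mulfK // k13r (k23r s) => E.
    have {}E : k12 (s * t) = k12 t * (k12 s / k12 1).
      by apply: (mulIf k23n1); rewrite E; ring.
    by rewrite /k E; ring.
exists (k12 1) => // s t.
have [->|s0] := eqVneq s 0.
  exists (k12 1)^-1 => z; rewrite scale0r add0r sipZl mul0r add0r.
  by field.
have [_ [l l0 H]] := k12P (t / s).
exists l => z.
have -> : s *: e1 + t *: e2 = s *: (e1 + (t / s) *: e2).
  by rewrite scalerDr scalerA [s * _]mulrC divfK.
rewrite sipZl H.
have -> : k12 (t / s) = k12 1 * (t / s).
  by rewrite -[in RHS](kid (t / s)) /k [RHS]mulrC divfK.
by field.
Qed.

(** Since [j e1 e2 = 0], the right side is [j e1 (c *: e1 + e2)]: this is symmetry of [j] for the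
    pair [e1], [c *: e1 + e2]. *)
Lemma frame_orthonormal c : j (c *: e1 + e2) e1 = c * j e1 e1.
Proof.
have [a a0 H] := frame_linear.
pose B s t s' t' := s * s' * j e1 e1 + a * t * (s' * j e2 e1 + t' * j e2 e2).
have jB s t : exists l, forall s' t',
    j (s *: e1 + t *: e2) (s' *: e1 + t' *: e2) = l * B s t s' t'.
  have [l Hl] := H s t; exists l => s' t'.
  by rewrite Hl !jD !jZ j12 /B; ring.
have indep s t : s *: e1 + t *: e2 = 0 -> s = 0 /\ t = 0.
  move=> E; have : s * j e1 e1 = 0.
    by have := congr1 (j e1) E; rewrite jD !jZ j12 mulr0 addr0 sip0.
  move/eqP; rewrite mulf_eq0 (negPf d1) orbF => /eqP s0; split=> //.
  move: E; rewrite s0 scale0r add0r => /eqP.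
  by rewrite scaler_eq0 (negPf e20) orbF => /eqP.
have Bn0 s t : (s != 0) || (t != 0) -> B s t s t != 0.
  move=> st; have [l Hl] := jB s t.
  apply/eqP => B0; have := Hl s t; rewrite B0 mulr0 jxx => /eqP.
  rewrite expf_eq0 normr_eq0 => /eqP /indep[s0 t0].
  by move: st; rewrite s0 t0 eqxx.
pose r := Num.sqrt (j e1 e1).
have p1 := sip_gt0 e10; have p2 := sip_gt0 e20.
have r0 : 0 < r by rewrite sqrtr_gt0.
have rE : j e1 e1 = r ^+ 2 by rewrite sqr_sqrtr // ltW.
(* Completing the square: [B s t s t] is [r ^+ 2 * (s + b * t) ^+ 2] plus
   [(a * j e2 e2 - b ^+ 2 * r ^+ 2) * t ^+ 2]. *)
have [b bE] : exists b, a * j e2 e1 = 2 * r ^+ 2 * b.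
  by exists (a * j e2 e1 / (2 * r ^+ 2)); field; rewrite gt_eqF.
(* Otherwise [B] has the isotropic vector [(w - b, 1)], against [Bn0]. *)
have D0 : 0 < a * j e2 e2 - b ^+ 2 * r ^+ 2.
  rewrite ltNge; apply/negP => D0.
  pose w := Num.sqrt ((b ^+ 2 * r ^+ 2 - a * j e2 e2) / r ^+ 2).
  have w2 : w ^+ 2 = (b ^+ 2 * r ^+ 2 - a * j e2 e2) / r ^+ 2.
    by rewrite sqr_sqrtr // divr_ge0 ?sqr_ge0 //; lra.
  have := @Bn0 (w - b) 1; rewrite oner_eq0 orbT => /(_ isT) /eqP[].
  rewrite /B rE.
  have -> : a * 1 * ((w - b) * j e2 e1 + 1 * j e2 e2) =
     (w - b) * (a * j e2 e1) + a * j e2 e2 by ring.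
  rewrite bE.
  have -> : (w - b) * (w - b) * r ^+ 2 +
      ((w - b) * (2 * r ^+ 2 * b) + a * j e2 e2)
    = w ^+ 2 * r ^+ 2 - b ^+ 2 * r ^+ 2 + a * j e2 e2 by ring.
  by rewrite w2 divfK ?expf_neq0 ?gt_eqF //; ring.
pose w := Num.sqrt (a * j e2 e2 - b ^+ 2 * r ^+ 2).
have w0 : 0 < w by rewrite sqrtr_gt0.
have wE : a * j e2 e2 = w ^+ 2 + b ^+ 2 * r ^+ 2.
  by rewrite sqr_sqrtr ?ltW //; ring.
(* [V] runs over the ellipse [B v v = 1]; the antisymmetric part of [B] takes
   the constant value [k] on the conjugate radii [V u], [V (u + pi / 2)]. *)
pose S th : R := cos th / r - b * sin th / w.
pose T th : R := sin th / w.
pose V th := S th *: e1 + T th *: e2.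
pose k := - (r * b / w).
have rn0 : r != 0 by rewrite gt_eqF.
have wn0 : w != 0 by rewrite gt_eqF.
have BV u h : B (S u) (T u) (S (u + h)) (T (u + h)) = cos h + k * sin h.
  have hE : h = (u + h) - u by ring.
  rewrite /B rE.
  have -> : a * T u * (S (u + h) * j e2 e1 + T (u + h) * j e2 e2) =
     T u * (S (u + h) * (a * j e2 e1) + T (u + h) * (a * j e2 e2)) by ring.
  rewrite bE wE /S /T /k.
  have -> : cos h = cos u * cos (u + h) + sin u * sin (u + h).
    by rewrite {1}hE cosB; ring.
  have -> : sin h = cos u * sin (u + h) - sin u * cos (u + h).
    by rewrite {1}hE sinB; ring.
  by field; rewrite rn0 wn0.
have BV1 u : B (S u) (T u) (S u) (T u) = 1.
  by have := BV u 0; rewrite addr0 cos0 sin0 mulr0 addr0.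
have V0 u : 0 < `|V u|.
  rewrite normr_gt0; apply/eqP => /indep[S0 T0].
  have := BV1 u; rewrite S0 T0 /B => /eqP; rewrite !(mul0r, mulr0) addr0 eq_sym.
  by rewrite oner_eq0.
have VB u s t : j (V u) (s *: e1 + t *: e2) = `|V u| ^+ 2 * B (S u) (T u) s t.
  have [l Hl] := jB (S u) (T u); rewrite Hl; congr (_ * _).
  by rewrite -jxx {2}/V Hl BV1 mulr1.
have Vpi u : cos u = -1 -> sin u = 0 -> `|V u| = `|V 0|.
  move=> cu su; rewrite /V /S /T cu su cos0 sin0 !mulr0 !mul0r !subr0.
  by rewrite !scale0r !addr0 mulN1r scaleNr normrN mul1r.
(* The growth inequality is [j (V u) (V (u + h)) <= |V u| * |V (u + h)|] divided by [|V u|]; the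
   values at [pi] and [- pi] agree with that at [0] because [V] changes sign there. *)
have [|||k0 Vc] := @growth_const R (fun u => `|V u|) k V0.
- by apply: Vpi; [exact: cospi|exact: sinpi].
- by apply: Vpi; [rewrite cosN cospi|rewrite sinN sinpi oppr0].
- move=> u h; rewrite -(BV u) -(ler_pM2l (V0 u)) mulrA -expr2 -VB.
  exact: le_trans (ler_norm _) (jle _ _).
have b0 : b = 0.
  move/eqP: k0; rewrite oppr_eq0 !mulf_eq0 invr_eq0 (negPf rn0) (negPf wn0).
  rewrite orbF.
  by move=> /eqP.
have V1 u : `|V u| ^+ 2 = 1.
  rewrite Vc /V /S /T cos0 sin0 b0 !mul0r subr0 scale0r addr0 normrZ exprMn.
  rewrite -(jxx e1) rE real_normK ?num_real //; field; exact: rn0.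
have j21 : j e2 e1 = 0.
  by move/eqP: bE; rewrite b0 mulr0 mulf_eq0 (negPf a0) => /eqP.
have a1 : a = 1.
  have := V1 (pi / 2); rewrite /V /S /T cos_pihalf sin_pihalf b0 !mul0r subr0.
  rewrite scale0r add0r normrZ exprMn -(jxx e2) real_normK ?num_real //.
  rewrite mul1r => E; apply: (mulIf d2); rewrite wE b0 mul1r.
  have -> : j e2 e2 = w ^+ 2 * (w^-1 ^+ 2 * j e2 e2) by field.
  by rewrite E; ring.
(* Polar coordinates on the ellipse, whose axes are now [e1] and [e2]: [c *: e1 + e2 = q *: V u]
   with [q * cos u = r * c] and [q * sin u = w]. *)
pose q := Num.sqrt ((r * c) ^+ 2 + w ^+ 2).
have q2 : q ^+ 2 = (r * c) ^+ 2 + w ^+ 2.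
  by rewrite sqr_sqrtr // addr_ge0 ?sqr_ge0.
have q0 : 0 < q by rewrite sqrtr_gt0 ltr_wpDl ?sqr_ge0 // exprn_gt0.
have qn0 : q != 0 by rewrite gt_eqF.
pose x := r * c / q.
have x2 : 1 - x ^+ 2 = (w / q) ^+ 2.
  by rewrite /x !expr_div_n q2; field; rewrite -q2 expf_neq0.
have x1 : -1 <= x <= 1.
  rewrite -ler_norml -(@ler_pXn2r _ 2) ?nnegrE // real_normK ?num_real //.
  by rewrite expr1n -subr_ge0 x2 sqr_ge0.
pose u := acos x.
have cu : cos u = x by rewrite acosK // in_itv.
have su : sin u = w / q.
  by rewrite sin_acos // x2 sqrtr_sqr ger0_norm // divr_ge0 // ltW.
have -> : c *: e1 + e2 = q *: V u.
  rewrite /V /S /T b0 cu su !mul0r subr0 scalerDr !scalerA /x.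
  congr (_ *: _ + _); first by field; rewrite rn0.
  by rewrite -[LHS]scale1r; congr (_ *: _); field; rewrite wn0.
have := VB u 1 0; rewrite scale1r scale0r addr0 sipZl => ->.
rewrite V1 /B j21 /S b0 cu /x rE; field.
by rewrite ?rn0 ?qn0 ?wn0.
Qed.
End Frame.
(** One-sided Gram-Schmidt on [x], [y] and a vector outside their span yields a frame to which
    [frame_orthonormal] applies. *)
Lemma sip_sym x y : j x y = j y x.
Proof.
have [->|x0] := eqVneq x 0; first by rewrite sip0l sip0.
have p1 := sip_gt0 x0.
pose c := j x y / j x x; pose e2 := y - c *: x.
have yE : y = c *: x + e2 by rewrite addrC subrK.
have [e20|e20] := eqVneq e2 0.
  by rewrite yE e20 addr0 jZ sipZl.
have p2 := sip_gt0 e20.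
have j12 : j x e2 = 0.
  by rewrite jD -scaleNr jZ mulNr divfK ?subrr // gt_eqF.
have [z zP] := dim3 x e2.
pose a := j x z / j x x; pose z' := z - a *: x.
pose b := j e2 z' / j e2 e2; pose e3 := z' - b *: e2.
have e30 : e3 != 0.
  apply: contraNneq (zP a b) => e30.
  by rewrite -subr_eq0 opprD addrA -/z' -/e3 e30.
have j13 : j x e3 = 0.
  rewrite jD -scaleNr jZ j12 mulr0 addr0 jD -scaleNr jZ mulNr divfK ?subrr //.
  by rewrite gt_eqF.
have j23 : j e2 e3 = 0.
  by rewrite jD -scaleNr jZ mulNr divfK ?subrr // gt_eqF.
rewrite [in RHS]yE (@frame_orthonormal x e2 e3) // yE jD jZ j12; lra.
Qed.

End SemiInnerProduct.

(** * Closedness of lines and planes; functionals in the dual *)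

Lemma bounded_linear_cts (R : realType) (V W : normedModType R) (f : V -> W) C :
  linear f -> (forall x, `|f x| <= C * `|x|) -> continuous f.
Proof.
move=> lf fC.
pose fL : {linear V -> W} := HB.pack f (GRing.isLinear.Build R V W *:%R f lf).
apply: (bounded_linear_continuous (f := fL)); apply/linear_boundedP.
near=> r => x; apply: le_trans (fC x) _; apply: ler_wpM2r.
  exact: normr_ge0.
by near: r; apply: nbhs_pinfty_ge; rewrite num_real.
Unshelve. all: by end_near. Qed.

Lemma closed_kernel (R : realType) (V W : normedModType R) (f : V -> W) C :
  linear f -> (forall x, `|f x| <= C * `|x|) -> closed [set x | f x = 0].
Proof.
move=> lf fC; rewrite (_ : [set x | _] = f @^-1` [set 0]) //.
apply: preimage_closed => [x _|]; first exact: bounded_linear_cts lf fC x.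
apply: accessible_closed_set1; apply: hausdorff_accessible; exact: norm_hausdorff.
Qed.

Definition line (R : realType) (V : normedModType R) (u : V) : set V :=
  range (fun a : R => a *: u).

Lemma closed_subspace_line (R : realType) (V : normedModType R) (u : V)
    (phi : V -> R) K :
  (forall a x y, phi (a *: x + y) = a * phi x + phi y) ->
  (forall x, `|phi x| <= K * `|x|) -> phi u = 1 -> closed_subspace (line u).
Proof.
move=> lphi bphi phiu; split.
  split; first by rewrite inE; exists 0; rewrite ?scale0r.
  move=> a _ _ /set_mem[b _ <-] /set_mem[c _ <-]; rewrite inE.
  by exists (a * b + c); rewrite // scalerDl scalerA.
pose D x := x - phi x *: u.
have -> : line u = [set x | D x = 0].
  apply/seteqP; split=> [_ [a _ <-]|x /= /eqP]; rewrite /D.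
    have phi0 : phi 0 = 0 by have := lphi 1 0 0; rewrite scale1r addr0; lra.
    have := lphi a u 0; rewrite /= addr0 phi0 addr0 phiu mulr1 => ->.
    exact: subrr.
  by rewrite subr_eq0 => /eqP ->; exists (phi x).
apply: (@closed_kernel _ _ _ D (1 + K * `|u|)).
  by move=> a x y; rewrite /D lphi scalerDl -scalerA scalerBr opprD addrACA.
move=> x; apply: le_trans (ler_normB _ _) _; rewrite mulrDl mul1r lerD2l normrZ.
by rewrite mulrAC ler_wpM2r.
Qed.

(** [phi] and [psi] are dual to [p] and [q], so the plane is the kernel of the identity minus a
    bounded projection. *)
Lemma closed_add_lines (R : realType) (V : normedModType R) (p q : V)
    (phi psi : V -> R) K L :
  (forall a x y, phi (a *: x + y) = a * phi x + phi y) ->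
  (forall a x y, psi (a *: x + y) = a * psi x + psi y) ->
  (forall x, `|phi x| <= K * `|x|) -> (forall x, `|psi x| <= L * `|x|) ->
  phi p = 1 -> phi q = 0 -> psi p = 0 -> psi q = 1 ->
  closed (set_add (line p) (line q)).
Proof.
move=> lphi lpsi bphi bpsi pp pq qp qq.
pose D x := x - (phi x *: p + psi x *: q).
have -> : set_add (line p) (line q) = [set x | D x = 0].
  apply/seteqP; split=> [_ [_ [a _ <-] [_ [b _ <-] <-]]|x /= /eqP];
    rewrite /D /=.
    have phi0 : phi 0 = 0 by have := lphi 1 0 0; rewrite scale1r addr0; lra.
    have psi0 : psi 0 = 0 by have := lpsi 1 0 0; rewrite scale1r addr0; lra.
    have phiE : phi (a *: p + b *: q) = a.
      by rewrite lphi -[b *: q]addr0 lphi pp pq phi0; lra.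
    have psiE : psi (a *: p + b *: q) = b.
      by rewrite lpsi -[b *: q]addr0 lpsi qp qq psi0; lra.
    by rewrite phiE psiE subrr.
  by rewrite subr_eq0 => /eqP ->; exists (phi x *: p); [exists (phi x)|
    exists (psi x *: q); [exists (psi x)|]].
apply: (@closed_kernel _ _ _ D (1 + (K * `|p| + L * `|q|))).
  move=> a x y; rewrite /D lphi lpsi !scalerDl -!scalerA scalerBr scalerDr.
  by rewrite [in LHS]addrACA opprD addrACA.
move=> x; apply: le_trans (ler_normB _ _) _; rewrite mulrDl mul1r lerD2l.
apply: le_trans (ler_normD _ _) _; rewrite !normrZ mulrDl ![_ * `|x|]mulrAC.
by apply: lerD; apply: ler_wpM2r.
Qed.

Lemma dual_ext (R : realType) (X : normedModType R) (g : X -> R) C :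
  (forall y z, g (y + z) = g y + g z) -> (forall a y, g (a *: y) = a * g y) ->
  (forall y, `|g y| <= C * `|y|) -> exists f : dual X, forall y, f y = g y.
Proof.
move=> gD gZ gC.
have lg : linear (g : X -> R^o) by move=> a x y; rewrite gD gZ.
have cg : (g : X -> R^o) \in cont_linear X.
  rewrite inE; split=> //; exact: (@bounded_linear_cts R X R^o g C lg gC).
by exists (Dual cg).
Qed.

Lemma dual_norm_leM (R : realType) (X : normedModType R) (f : dual X) r :
  0 <= r -> (forall x, `|f x| <= r * `|x|) -> `|f| <= r.
Proof.
move=> r0 fr; apply: dual_norm_le => x x1; apply: le_trans (fr x) _.
by rewrite ler_piMr.
Qed.

Lemma dualBE (R : realType) (X : normedModType R) (f g : dual X) x :
  (f - g) x = f x - g x.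
Proof. by []. Qed.

Lemma dual_applyD (R : realType) (X : normedModType R) (f : dual X) x y :
  f (x + y) = f x + f y.
Proof. exact: linearD. Qed.

Lemma dual_applyZ (R : realType) (X : normedModType R) (f : dual X) a x :
  f (a *: x) = a * f x.
Proof. exact: linearZ. Qed.

(** * The duality map of a smooth space *)

Section DualityMap.
Context {R : realType} {X : normedModType R}.
Context (smoothX : smooth X).

(** Smoothness gives the functional norming [x / |x|], which is scaled by [|x|]. For uniqueness
    [|f| <= |x|] suffices, since [f x = |x| ^+ 2] forces the reverse inequality when [x != 0]. *)
Lemma duality_map_exists :
  exists J : X -> dual X, forall x, [/\ `|J x| = `|x|, J x x = `|x| ^+ 2 &
    forall f : dual X, `|f| <= `|x| -> f x = `|x| ^+ 2 -> f = J x].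
Proof.
suff /choice[J JP] : forall x, exists f : dual X, [/\ `|f| = `|x|,
    f x = `|x| ^+ 2 & forall g : dual X, `|g| <= `|x| -> g x = `|x| ^+ 2 -> g = f].
  by exists J.
move=> x; have [->|x0] := eqVneq x 0.
  exists 0; rewrite !normr0 expr0n; split=> // g.
  by rewrite normr_le0 => /eqP.
have nx : 0 < `|x| by rewrite normr_gt0.
have nx0 : `|x| != 0 by rewrite gt_eqF.
have u1 : `| `|x|^-1 *: x | = 1 by rewrite normrZ normfV normr_id mulVf.
have [f [[f1 fu] funiq]] := smoothX u1.
have fx : f x = `|x|.
  move: fu; rewrite linearZ => fu; rewrite -[RHS]mulr1 -fu.
  by rewrite /= /GRing.scale /= mulrA divff // mul1r.
exists (`|x| *: f); split.
- by rewrite normrZ f1 mulr1 normr_id.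
- by rewrite dualZE fx.
move=> g gx gxx.
suff -> : f = `|x|^-1 *: g by rewrite scalerA divff // scale1r.
apply: funiq.
have gu : (`|x|^-1 *: g) (`|x|^-1 *: x) = 1.
  rewrite dualZE linearZ /= gxx /GRing.scale /=.
  by field.
split=> //; apply/eqP; rewrite eq_le; apply/andP; split.
  by rewrite normrZ normfV normr_id ler_pdivrMl // mulr1.
have := dual_norm_bound (`|x|^-1 *: g) (`|x|^-1 *: x).
by rewrite gu u1 mulr1 normr1.
Qed.
End DualityMap.

(** * Property SU for lines and planes *)

Section SubspaceSU.
Context {R : realType} {X : normedModType R} {J : X -> dual X}.
Context (JP : forall x, [/\ `|J x| = `|x|, J x x = `|x| ^+ 2 &
    forall f : dual X, `|f| <= `|x| -> f x = `|x| ^+ 2 -> f = J x]).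

Lemma closed_subspace_line_smooth (x : X) : x != 0 -> closed_subspace (line x).
Proof.
move=> x0; have [Jn Jx _] := JP x; have x2 : `|x| ^+ 2 != 0.
  by rewrite expf_eq0 normr_eq0.
apply: (@closed_subspace_line _ _ _ (fun y => J x y / `|x| ^+ 2)
    (`|J x| / `|x| ^+ 2)).
- by move=> a y z; rewrite linearP /= mulrDl mulrA.
- move=> y; rewrite normrM normfV [X in _ / X]ger0_norm ?sqr_ge0 // mulrAC.
  by rewrite ler_wpM2r ?invr_ge0 ?sqr_ge0 // dual_norm_bound.
- by rewrite Jx divff.
Qed.

(** The complement is the line of [J x]. If [f = a *: J x + h] were no longer than [a *: J x] with
    [a != 0], then [a^-1 *: f] would also norm [x], so uniqueness gives [h = 0]. *)
Lemma property_SU_line (x : X) : x != 0 -> property_SU (line x).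
Proof.
move=> x0; have [Jn Jx Juniq] := JP x.
have nx : 0 < `|x| by rewrite normr_gt0.
have x2 : `|x| ^+ 2 != 0 by rewrite expf_eq0 normr_eq0.
exists (line (J x)); split.
- apply: (@closed_subspace_line _ _ _ (fun f : dual X => f x / `|x| ^+ 2)
      (`|x| / `|x| ^+ 2)).
  + by move=> a f g; rewrite dualDE dualZE mulrDl mulrA.
  + move=> f; rewrite normrM normfV [X in _ / X]ger0_norm ?sqr_ge0 // mulrAC.
    by rewrite ler_wpM2r ?invr_ge0 ?sqr_ge0 // mulrC dual_norm_bound.
  + by rewrite Jx divff.
- split.
    apply/seteqP; split=> [_ [[a _ <-] H]|_ ->] /=.
      have /eqP : (a *: J x) x = 0 by apply: H; exists 1; rewrite ?scale1r.
      by rewrite dualZE Jx mulf_eq0 (negPf x2) orbF => /eqP ->; rewrite scale0r.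
    by split=> [|y _ //]; exists 0; rewrite ?scale0r.
  apply/seteqP; split=> // f _.
  exists ((f x / `|x| ^+ 2) *: J x); first by exists (f x / `|x| ^+ 2).
  exists (f - (f x / `|x| ^+ 2) *: J x); last by rewrite addrC subrK.
  move=> _ [a _ <-]; rewrite dual_applyZ dualBE dualZE Jx divfK //.
  by rewrite subrr mulr0.
- move=> f g h [a _ <-] hx fE h0.
  have hx0 : h x = 0 by apply: hx; exists 1; rewrite ?scale1r.
  rewrite ltNge; apply/negP => fg; move: h0 => /eqP; apply.
  have [a0|a0] := eqVneq a 0.
    apply/eqP; move: fg; rewrite fE a0 scale0r normr0 add0r normr_le0 => //.
  have : a^-1 *: f = J x.
    apply: Juniq.
      rewrite normrZ normfV ler_pdivrMl ?normr_gt0 //.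
      by rewrite (le_trans fg) // normrZ Jn.
    by rewrite dualZE fE dualDE dualZE hx0 addr0 mulrA mulVf // mul1r Jx.
  rewrite fE scalerDr scalerA mulVf // scale1r => /eqP.
  rewrite -subr_eq0 addrAC subrr add0r scaler_eq0.
  by rewrite invr_eq0 (negPf a0) => /eqP.
Qed.

(* A functional norming a point of Y decomposes along G with no component in
   the annihilator: otherwise its G-part would be shorter while still norming. *)
Lemma norming_functional_SU (Y : set X) (G : set (dual X)) y :
  complementary G (annihilator Y) ->
  (forall f g h : dual X, G g -> annihilator Y h -> f = g + h ->
          h != 0 -> `|f| > `|g|) -> Y y -> G (J y).
Proof.
move=> [_ GY] GS Yy; have [Jn Jy _] := JP y.
have : [set: dual X] (J y) by [].
rewrite -GY => -[g Gg [h Yh E]].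
have [h0|h0] := eqVneq h 0; first by rewrite -E h0 addr0.
have := GS _ g h Gg Yh (esym E) h0; rewrite Jn ltNge => /negP[].
have gy : g y = `|y| ^+ 2 by rewrite -Jy -E dualDE (Yh y Yy) addr0.
have [->|y0] := eqVneq y 0; first by rewrite normr0.
have := dual_norm_bound g y; rewrite gy ger0_norm ?sqr_ge0 // expr2.
by rewrite ler_pM2r // normr_gt0.
Qed.

Context (sumSU : forall Y Z : set X,
     closed_subspace Y -> closed_subspace Z ->
     property_SU Y -> property_SU Z ->
     closed (set_add Y Z) ->
     property_SU (set_add Y Z)).

(** The complement [G] of the plane's annihilator contains [J] of every point of the plane, and an
    element of [G] vanishing at [p] and [q] is zero. *)
Lemma duality_map_span (p q : X) a b :
  J p p * J q q != J p q * J q p ->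
  exists c d, forall z, J (a *: p + b *: q) z = c * J p z + d * J q z.
Proof.
rewrite -subr_eq0; set D := _ - _ => D0.
have p0 : p != 0.
  by apply: contraNneq D0 => p0; rewrite /D p0 !linear0 !(mulr0, mul0r) subrr.
have q0 : q != 0.
  by apply: contraNneq D0 => q0; rewrite /D q0 !linear0 !(mulr0, mul0r) subrr.
(* Cramer's rule gives the basis dual to [p], [q] inside the span of [J p] and [J q]. *)
pose phi : dual X := (J q q / D) *: J p - (J p q / D) *: J q.
pose psi : dual X := (J p p / D) *: J q - (J q p / D) *: J p.
have lin (f : dual X) u x y : f (u *: x + y) = u * f x + f y.
  by rewrite dual_applyD dual_applyZ.
have [|||||G [[[G0 GL] _] GY GS]] := @sumSU (line p) (line q).
- exact: closed_subspace_line_smooth.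
- exact: closed_subspace_line_smooth.
- exact: property_SU_line.
- exact: property_SU_line.
- apply: (@closed_add_lines _ _ p q phi psi `|phi| `|psi|).
  + exact: lin.
  + exact: lin.
  + exact: dual_norm_bound.
  + exact: dual_norm_bound.
  + by rewrite dualBE !dualZE -(divff D0) /D; field.
  + by rewrite dualBE !dualZE; field.
  + by rewrite dualBE !dualZE; field.
  + by rewrite dualBE !dualZE -(divff D0) /D; field.
have YP s t : set_add (line p) (line q) (s *: p + t *: q).
  by exists (s *: p); [exists s|exists (t *: q); [exists t|]].
have GJ s t : G (J (s *: p + t *: q)) by apply: norming_functional_SU (YP s t).
set f := J (a *: p + b *: q).
(* Cramer's rule again: [c *: J p + d *: J q] agrees with [f] at [p] and [q]. *)
pose c := (f p * J q q - f q * J q p) / D.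
pose d := (f q * J p p - f p * J p q) / D.
exists c, d => z.
have fp : f p = c * J p p + d * J q p by rewrite /c /d /D; field.
have fq : f q = c * J p q + d * J q q by rewrite /c /d /D; field.
have : [set 0] (f - (c *: J p + d *: J q)).
  case: GY => <- _; split.
    have -> : f - (c *: J p + d *: J q) = - c *: J p + (- d *: J q + f).
      by rewrite opprD addrC -addrA !scaleNr.
    apply/set_mem/GL; last apply: GL; apply/mem_set; last exact: GJ.
    + by have := GJ 1 0; rewrite scale1r scale0r addr0.
    + by have := GJ 0 1; rewrite scale1r scale0r add0r.
  move=> _ [_ [s _ <-] [_ [t _ <-] <-]].
  rewrite dualBE dualDE !dualZE !dual_applyD !dual_applyZ fp fq; ring.
move=> /= /eqP; rewrite subr_eq0 => /eqP ->.
by rewrite dualDE !dualZE.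
Qed.
End SubspaceSU.

(** * Dimension count and conclusion *)

Lemma dim_gt_not_span2 (R : realType) (X : normedModType R) n : dim_gt X n ->
  (1 < n)%N -> forall x y : X, exists z, forall a b, z != a *: x + b *: y.
Proof.
move=> [e eP] n1 x y; apply: contrapT => H.
have {H} : forall i, exists ab : R * R, e i = ab.1 *: x + ab.2 *: y.
  move=> i; apply: contrapT => Hi; apply: H; exists (e i) => a b.
  by apply/eqP => E; apply: Hi; exists (a, b).
move=> /choice[f fP].
pose M : 'M[R]_(n.+1, 2) := \matrix_(i, k) if k == 0 then (f i).1 else (f i).2.
(* The rows are the coordinates of the [e i] in [x], [y]; rank at most 2 leaves a nontrivial
   relation among more than two rows. *)
have : kermx M != 0.
  rewrite -mxrank_eq0 mxrank_ker -lt0n subn_gt0.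
  by rewrite (leq_ltn_trans (rank_leq_col M)).
move=> /rowV0Pn[v /sub_kermxP vM v0].
have v00 i : v 0 i = 0.
  apply: eP i.
  under eq_bigr do rewrite fP scalerDr !scalerA.
  rewrite big_split /= -!scaler_suml.
  have E k : \sum_i v 0 i * M i k = 0.
    by have := congr1 (fun A : 'rV[R]_2 => A 0 k) vM; rewrite !mxE.
  have := E 0; under eq_bigr do rewrite mxE eqxx; move=> ->.
  have := E 1; under eq_bigr do rewrite mxE /=; move=> ->.
  by rewrite !scale0r addr0.
by move/eqP: v0; apply; apply/rowP => i; rewrite mxE v00.
Qed.

Lemma sip_hilbert (R : realType) (H : completeNormedModType R)
    (j : H -> H -> R) :
  semi_inner_product j -> (forall x y, j x y = j y x) -> is_hilbert H.
Proof.
move=> jP jC.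
have jbil : bilinear_for *%R (idfun \; *%R) j.
  by split=> u a x y /=; rewrite ?(jC _ u) (sipD jP) (sipZ jP) // !(jC u).
have jpos u : u != 0 -> 0 < j u u by exact: sip_gt0.
pose ip : {dot H for (@idfun R)} := HB.pack j
  (bilinear_isBilinear.Build R H H R *%R ((@idfun R) \; *%R) j jbil)
  (isHermitianSesquilinear.Build R H false idfun j
    (fun x y => etrans (jC x y) (esym (mul1r _))))
  (isDotProduct.Build R H j jpos).
by exists ip => u; rewrite -(sipxx jP).
Qed.

Theorem theorem5p6 (R : realType) (X : completeNormedModType R) :
  smooth X ->
  dim_gt X 3 ->
  (forall Y Z : set X,
     closed_subspace Y -> closed_subspace Z ->
     property_SU Y -> property_SU Z ->
     closed (set_add Y Z) ->
     property_SU (set_add Y Z)) ->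
  exists H : completeNormedModType R, is_hilbert H /\ isometric X H.
Proof.
move=> smoothX dimX sumSU.
have [J JP] := duality_map_exists smoothX.
have jP : semi_inner_product (fun x y => J x y : R).
  split.
  - by move=> x y z; rewrite linearD.
  - by move=> x a y; rewrite linearZ.
  - by move=> x; case: (JP x).
  - by move=> x y; case: (JP x) => <- _ _; exact: dual_norm_bound.
  - move=> x g gD gZ gx gxx y.
    have [f fg] := dual_ext gD gZ gx; case: (JP x) => _ _ /(_ f) <- //.
      by apply: dual_norm_leM => // z; rewrite fg.
    by rewrite fg.
  - by move=> p q a b; exact: duality_map_span.
exists X; split; last by exists idfun; split=> //; exists idfun.
apply: (sip_hilbert jP); apply: sip_sym jP _.
exact: dim_gt_not_span2 dimX _.
Qed.
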